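(* For all $L\in\{2,3,\ldots\}$ and $a>200L$ there exist $q\in(0,1)$ and an isometry-invariant kernel $J$ on $\mathbb{H}^1_L$ satisfying $J\sim aL\,n^{-2}\log\log(n)$ such that $\mathbb{P}_{q,J}(|K_0|=\infty)>0$.
   Context: $\mathbb{H}^1_L$ is the group $\bigoplus_{i=1}^\infty\mathbb{Z}/L\mathbb{Z}$ with ultrametric $\|x-y\|=L^{\max\{i:x_i\neq y_i\}}$ for $x\neq y$; edges are unordered pairs $e=\{x,y\}$ of distinct vertices with $|e|=\|x-y\|$. A kernel $J:E\to[0,\infty)$ is isometry-invariant if $J(e)=J(f)$ whenever $|e|=|f|$. $J\sim f$ means $\lim_{|e|\to\infty}J(e)/f(|e|)=1$. For $q\in[0,1]$, $\mathbb{P}_{q,J}$ is the law of the random graph in which each vertex is open independently with probability $q$ and, independently, each edge between open vertices is open independently with probability $1-\exp(-J(e))$; $K_0$ is the open cluster of the origin. *)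

(* Defs.v *)
From HB Require Import structures.
From mathcomp Require Import all_boot all_order all_algebra.
From mathcomp Require Import all_classical all_reals all_analysis.
From Stdlib Require Import Relation_Operators.
Set Implicit Arguments. Unset Strict Implicit. Unset Printing Implicit Defensive.
Import Order.TTheory GRing.Theory Num.Theory.
Local Open Scope classical_set_scope.
Local Open Scope ring_scope.

(* The hierarchical lattice H^1_L = (+)_{i>=1} Z/LZ: finitely supported
   sequences with entries in {0,..,L-1}.  Coordinate i >= 1 of the paper is
   stored at index i-1. *)
Definition HL (L : nat) : Type :=
  {x : nat -> nat | (forall i, (x i < L)%N) /\ exists N, forall i, (N <= i)%N -> x i = 0%N}.


(* level x y = the least n such that x and y agree at all coordinates > n
   (1-indexed); for x <> y it equals max{i : x_i <> y_i} (1-indexed). *)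
Definition level (L : nat) (x y : HL L) : nat :=
  xget 0%N [set n : nat | (forall i, (n <= i)%N -> sval x i = sval y i) /\
     forall m : nat, (forall i, (m <= i)%N -> sval x i = sval y i) -> (n <= m)%N].

Definition hnorm (R : realType) (L : nat) (x y : HL L) : R := (L%:R) ^+ level x y.

Definition HEdge (L : nat) : Type :=
  {e : set (HL L) | exists x y : HL L, x <> y /\ e = [set x; y]}.

(* isometry-invariant kernel J : E -> [0,oo), represented as a symmetric
   function of the two endpoints *)
Definition iso_inv_kernel (R : realType) (L : nat) (J : HL L -> HL L -> R) : Prop :=
  (forall x y, x <> y -> 0 <= J x y) /\
  (forall x y, J x y = J y x) /\
  (forall x y x' y', x <> y -> x' <> y' ->
      hnorm R x y = hnorm R x' y' -> J x y = J x' y').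

Definition kernel_equiv (R : realType) (L : nat) (J : HL L -> HL L -> R) (f : R -> R) : Prop :=
  forall eps : R, 0 < eps -> exists M : R, forall x y, x <> y -> M <= hnorm R x y ->
     `| J x y / f (hnorm R x y) - 1 | < eps.

Definition mutually_independent (R : realType) (d : measure_display)
  (T : measurableType d) (P : probability T R) (I : Type) (X : I -> T -> bool) : Prop :=
  forall (n : nat) (f : 'I_n -> I), injective f -> forall b : 'I_n -> bool,
    P (\bigcap_(k in [set: 'I_n]) [set w | X (f k) w = b k]) =
    (\prod_(k < n) P [set w | X (f k) w = b k])%E.

Definition open_adj (L : nat) (T : Type) (om : HL L -> T -> bool)
  (eta : HEdge L -> T -> bool) (w : T) (x y : HL L) : Prop :=
  x <> y /\ om x w /\ om y w /\ exists e : HEdge L, sval e = [set x; y] /\ eta e w.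

Definition open_cluster (L : nat) (T : Type) (om : HL L -> T -> bool)
  (eta : HEdge L -> T -> bool) (o : HL L) (w : T) : set (HL L) :=
  [set v | om o w /\ clos_refl_trans (HL L) (open_adj om eta w) o v].

(* P_{q,J} realised on a probability space (T,P): vertex states om, edge
   states eta, all mutually independent, with the prescribed marginals *)
Definition is_PqJ (R : realType) (L : nat) (q : R) (J : HL L -> HL L -> R)
  (d : measure_display) (T : measurableType d) (P : probability T R)
  (om : HL L -> T -> bool) (eta : HEdge L -> T -> bool) : Prop :=
  (forall v, measurable [set w | om v w]) /\
  (forall e, measurable [set w | eta e w]) /\
  mutually_independent P (fun i : (HL L + HEdge L)%type =>
     match i with inl v => om v | inr e => eta e end) /\
  (forall v, P [set w | om v w] = q%:E) /\
  (forall (e : HEdge L) x y, x <> y -> sval e = [set x; y] ->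
      P [set w | eta e w] = (1 - expR (- J x y))%:E).

(* Main.v *)
(** Inside every block of level [k] build an open connected set recursively: at
    level [k+1] take the union of those children clusters whose density is at
    least 1/8, provided any two of them are joined by an open edge, and the
    empty set otherwise.  Let [X_k] be its density.  The children are independent,
    so averaging divides the variance of [X_k] by [L >= 2]; discarding the sparse
    children costs less than this gain as long as the mean stays above 3/4.  The
    probability that two dense children are not joined is at most a constant times
    [(k+1)^-2], because two clusters of density 1/8 have expected number of edges
    at least [2 ln (ln (L^(k+1)))].  A huge kernel on finitely many levels and [q]
    close to 1 make all these errors, and the sum of the variances, as small as
    needed.  Hence for every [k], with probability at least 1/2, the cluster of
    the origin leaves its block of level [k]; so with probability at least 1/2 it
    does so for infinitely many [k], and is then infinite. *)

Require Import Defs.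
From HB Require Import structures.
From mathcomp Require Import all_boot all_order all_algebra.
From mathcomp Require Import ring lra zify.
Set Implicit Arguments. Unset Strict Implicit. Unset Printing Implicit Defensive.
Import Order.TTheory GRing.Theory Num.Theory.
Local Open Scope ring_scope.

(** * Finite probability spaces *)

Section FiniteExpectation.
Variable R : realFieldType.

Definition Ex (W : finType) (m : W -> R) (f : W -> R) : R := \sum_w m w * f w.

Definition is_prob (W : finType) (m : W -> R) : Prop :=
  (forall w, 0 <= m w) /\ \sum_w m w = 1.

Lemma eq_Ex (W : finType) (m f g : W -> R) : f =1 g -> Ex m f = Ex m g.
Proof. by move=> fg; apply: eq_bigr => w _; rewrite fg. Qed.

Lemma ExD (W : finType) (m f g : W -> R) :
  Ex m (fun w => f w + g w) = Ex m f + Ex m g.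
Proof. by rewrite -big_split; apply: eq_bigr => w _; rewrite mulrDr. Qed.

Lemma ExZ (W : finType) (m f : W -> R) (t : R) :
  Ex m (fun w => t * f w) = t * Ex m f.
Proof. by rewrite /Ex mulr_sumr; apply: eq_bigr => w _; rewrite mulrCA. Qed.

Lemma ExB (W : finType) (m f g : W -> R) :
  Ex m (fun w => f w - g w) = Ex m f - Ex m g.
Proof.
rewrite -mulN1r -ExZ -ExD; apply: eq_Ex => w; by rewrite mulN1r.
Qed.

Lemma Ex_sum (W I : finType) (m : W -> R) (F : I -> W -> R) :
  Ex m (fun w => \sum_i F i w) = \sum_i Ex m (F i).
Proof.
rewrite /Ex exchange_big; apply: eq_bigr => w _; by rewrite mulr_sumr.
Qed.

Lemma Ex_const (W : finType) (m : W -> R) (t : R) :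
  is_prob m -> Ex m (fun=> t) = t.
Proof. by case=> _ m1; rewrite /Ex -mulr_suml m1 mul1r. Qed.

Lemma le_Ex (W : finType) (m f g : W -> R) :
  is_prob m -> (forall w, f w <= g w) -> Ex m f <= Ex m g.
Proof. by case=> m0 _ fg; apply: ler_sum => w _; apply: ler_wpM2l. Qed.

Lemma Ex_pair (W1 W2 : finType) (m1 : W1 -> R) (m2 : W2 -> R) f :
  Ex (fun w : W1 * W2 => m1 w.1 * m2 w.2) f =
  Ex m1 (fun u => Ex m2 (fun v => f (u, v))).
Proof.
rewrite /Ex; under [RHS]eq_bigr do rewrite mulr_sumr.
by rewrite pair_bigA /=; apply: eq_bigr => -[u v] _ /=; rewrite mulrA.
Qed.

Definition prodm (I W : finType) (m : W -> R) (c : {ffun I -> W}) : R :=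
  \prod_i m (c i).

Lemma Ex_prod (I W : finType) (m : W -> R) (F : I -> W -> R) :
  Ex (@prodm I W m) (fun c => \prod_i F i (c i)) = \prod_i Ex m (F i).
Proof.
rewrite /Ex /prodm (bigA_distr_bigA (fun i w => m w * F i w)) /=.
by apply: eq_bigr => c _; rewrite big_split.
Qed.

Lemma prodm_prob (I W : finType) (m : W -> R) :
  is_prob m -> is_prob (@prodm I W m).
Proof.
move=> [m0 m1]; split=> [c|]; first by apply: prodr_ge0 => i _.
rewrite /prodm -(bigA_distr_bigA (fun (i : I) w => m w)) /= big1 //.
Qed.

Lemma Ex_coord2 (I W : finType) (m : W -> R) (i j : I) (f g : W -> R) :
  is_prob m -> i != j ->
  Ex (@prodm I W m) (fun c => f (c i) * g (c j)) = Ex m f * Ex m g.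
Proof.
move=> mP ij.
(* The factor 1 at all other coordinates turns the product of two observables into a full product,
   so [Ex_prod] applies. *)
pose F l w := if l == i then f w else if l == j then g w else 1.
have prodF (G : I -> R) : (forall l, l != i -> l != j -> G l = 1) ->
    \prod_l G l = G i * G j.
  move=> G1; rewrite (bigD1 i) //= (bigD1 j) 1?eq_sym //= big1 ?mulr1 //.
  by move=> l /andP[li lj]; exact: G1.
transitivity (Ex (@prodm I W m) (fun c => \prod_l F l (c l))).
  apply: eq_Ex => c; rewrite prodF => [|l /negPf li /negPf lj].
    by rewrite /F eqxx (negPf (_ : j != i)) 1?eq_sym // eqxx.
  by rewrite /F li lj.
rewrite Ex_prod prodF => [|l /negPf li /negPf lj].
  congr (_ * _); apply: eq_Ex => w; rewrite /F ?eqxx //.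
  by rewrite (negPf (_ : j != i)) 1?eq_sym // eqxx.
by rewrite -[RHS](Ex_const 1 mP); apply: eq_Ex => w; rewrite /F li lj.
Qed.

Lemma Ex_coord (I W : finType) (m : W -> R) (i : I) (f : W -> R) :
  is_prob m -> Ex (@prodm I W m) (fun c => f (c i)) = Ex m f.
Proof.
move=> mP; pose F l w := if l == i then f w else 1.
transitivity (Ex (@prodm I W m) (fun c => \prod_l F l (c l))).
  apply: eq_Ex => c; rewrite (bigD1 i) //= big1 ?mulr1 /F ?eqxx //.
  by move=> l /negPf ->.
rewrite Ex_prod (bigD1 i) //= big1 ?mulr1 => [|l /negPf li].
  by apply: eq_Ex => w; rewrite /F eqxx.
by rewrite -[RHS](Ex_const 1 mP); apply: eq_Ex => w; rewrite /F li.
Qed.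

(** The mean minimizes the mean squared deviation. Variances can thus be bounded by centring at any
    convenient [t], without computing the true mean. *)
Lemma Ex_bias_var (W : finType) (m f : W -> R) (t : R) : is_prob m ->
  Ex m (fun w => (f w - Ex m f) ^+ 2) <= Ex m (fun w => (f w - t) ^+ 2).
Proof.
move=> mP; set e := Ex m f.
have -> : Ex m (fun w => (f w - t) ^+ 2) =
    Ex m (fun w => (f w - e) ^+ 2) + (e - t) ^+ 2.
  rewrite [in RHS](@eq_Ex _ _ _
    (fun w => (f w - t) ^+ 2 + ((-2 * (e - t)) * (f w - e) - (e - t) ^+ 2))).
    by rewrite ExD ExB ExZ ExB !(Ex_const _ mP) -/e; ring.
  by move=> w; ring.
by rewrite lerDl sqr_ge0.
Qed.

(** After expanding the square into a double sum, independence kills the off-diagonal terms and [n]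
    of the [n ^ 2] terms remain. This is the source of the contraction of the variance. *)
Lemma Ex_var_avg (n : nat) (W : finType) (m f : W -> R) : is_prob m ->
  (0 < n)%N ->
  Ex (@prodm 'I_n W m) (fun c => (n%:R^-1 * (\sum_i f (c i)) - Ex m f) ^+ 2) =
  n%:R^-1 * Ex m (fun w => (f w - Ex m f) ^+ 2).
Proof.
move=> mP n0; set e := Ex m f.
have nz : n%:R != 0 :> R by rewrite pnatr_eq0 -lt0n.
transitivity (Ex (@prodm 'I_n W m) (fun c => n%:R^-1 ^+ 2 *
   \sum_i \sum_j (f (c i) - e) * (f (c j) - e))).
  apply: eq_Ex => c; under [in RHS]eq_bigr do rewrite -mulr_sumr.
  rewrite -mulr_suml sumrB sumr_const card_ord -mulr_natl.
  by field.
rewrite ExZ Ex_sum (eq_bigr (fun=> Ex m (fun w => (f w - e) ^+ 2))).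
  rewrite sumr_const card_ord -[in LHS]mulr_natl; by field.
move=> i _; rewrite Ex_sum (bigD1 i) //= big1 ?addr0.
  by rewrite (@Ex_coord _ _ m i (fun w => (f w - e) * (f w - e))).
move=> j ji; rewrite (@Ex_coord2 _ _ m i j (fun w => f w - e) (fun w => f w - e)) //.
  by rewrite ExB Ex_const // subrr mul0r.
by rewrite eq_sym.
Qed.

Definition bern (p : R) (b : bool) : R := if b then p else 1 - p.

Lemma bern_prob p : 0 <= p <= 1 -> is_prob (bern p).
Proof.
case/andP=> p0 p1; split=> [[]|]; rewrite /= ?subr_ge0 //.
by rewrite big_bool /= addrC subrK.
Qed.

(** The indicator that no edge of [F] is open is a product of one factor per edge. *)
Lemma Ex_bern_closed (I : finType) (p : R) (F : {set I}) : 0 <= p <= 1 ->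
  Ex (@prodm I _ (bern p)) (fun h => (~~ [exists e, (e \in F) && h e])%:R) =
  (1 - p) ^+ #|F|.
Proof.
move=> p01.
transitivity (Ex (@prodm I _ (bern p))
    (fun h => \prod_e (if (e \in F) && h e then 0 else 1))).
  apply: eq_Ex => h; case: existsP => [[e eF]|nF] /=.
    by rewrite (bigD1 e) //= eF mul0r.
  by rewrite big1 // => e _; case: ifP => // eF; case: nF; exists e.
rewrite (Ex_prod _ (fun e b => if (e \in F) && b then 0 else 1)).
rewrite (bigID [in F]) /= [X in _ * X]big1 ?mulr1 => [|e /negPf eF].
  rewrite -prodr_const; apply: eq_bigr => e eF.
  by rewrite /Ex big_bool /= eF /= mulr0 add0r mulr1.
rewrite -[RHS](Ex_const 1 (bern_prob p01)).
by apply: eq_Ex => b; rewrite eF.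
Qed.

End FiniteExpectation.

(** * One renormalization step *)

Section MergeStep.
Variables (R : realFieldType) (l : nat).
Local Notation L := l.+2.

(* Potential edges between distinct children, one representative per edge. *)
Definition sib (V : finType) : finType :=
  {e : ('I_L * V) * ('I_L * V) | (e.1.1 < e.2.1)%N}.

Definition step_space (W V : finType) : finType :=
  ({ffun 'I_L -> W} * {ffun sib V -> bool})%type.

Definition step_weight (W V : finType) (m : W -> R) (p : R)
  (w : step_space W V) : R := prodm m w.1 * prodm (bern p) w.2.

(** Density at least 1/8, stated in integers so that it is decidable and free of division. *)
Definition large (V : finType) (A : {set V}) : bool := (#|V| <= 8 * #|A|)%N.

Definition linked (W V : finType) (C : W -> {set V}) (w : step_space W V)
  (i j : 'I_L) : bool :=
  [exists e : sib V, [&& (val e).1.1 == i, (val e).2.1 == j,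
     (val e).1.2 \in C (w.1 i), (val e).2.2 \in C (w.1 j) & w.2 e]].

Definition all_linked (W V : finType) (C : W -> {set V}) (w : step_space W V) :=
  [forall i : 'I_L, forall j : 'I_L,
    [&& (i < j)%N, large (C (w.1 i)) & large (C (w.1 j))] ==> linked C w i j].

Definition merged (W V : finType) (C : W -> {set V}) (w : step_space W V) :
  {set 'I_L * V} :=
  if all_linked C w then [set x | large (C (w.1 x.1)) && (x.2 \in C (w.1 x.1))]
  else set0.

Definition density (V : finType) (A : {set V}) : R := #|A|%:R / #|V|%:R.

Section OneStep.
Variables (W V : finType) (m : W -> R) (C : W -> {set V}) (p b : R).
Hypothesis mP : is_prob m.
Hypothesis p01 : 0 <= p <= 1.
Hypothesis V0 : (0 < #|V|)%N.
(* Two large clusters are joined by at least [#|V| ^ 2 / 64] potential edges. *)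
Hypothesis pb : forall n, (#|V| ^ 2 <= 64 * n)%N -> (1 - p) ^+ n <= b.

Local Notation mm := (@step_weight W V m p).
Local Notation X := (fun w => density (C w)).
Local Notation X' := (fun w => density (merged C w)).
Local Notation E := (Ex m X).
Local Notation Var := (Ex m (fun w => (X w - E) ^+ 2)).

Lemma step_prob : is_prob mm.
Proof.
have [p0 p1] := prodm_prob 'I_L mP.
have [b0 b1] := prodm_prob (sib V) (bern_prob p01).
split=> [w|]; first by rewrite mulr_ge0.
transitivity (Ex mm (fun=> 1)); first by apply: eq_bigr => w _; rewrite mulr1.
rewrite Ex_pair -[RHS](Ex_const 1 (prodm_prob 'I_L mP)); apply: eq_Ex => c.
exact: (Ex_const _ (prodm_prob _ (bern_prob p01))).
Qed.

Lemma Ex_step1 (f : {ffun 'I_L -> W} -> R) :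
  Ex mm (fun w => f w.1) = Ex (prodm m) f.
Proof.
rewrite Ex_pair; apply: eq_Ex => c /=.
exact: (Ex_const _ (prodm_prob _ (bern_prob p01))).
Qed.

Lemma large_density (A : {set V}) : large A = (1 / 8 <= density A).
Proof.
rewrite /density ler_pdivlMr ?ltr0n // /large -(ler_nat R) natrM.
by apply/idP/idP => h; lra.
Qed.

Lemma density_ge0 (U : finType) (A : {set U}) : 0 <= density A.
Proof. by rewrite divr_ge0. Qed.

Lemma density_le1 (U : finType) (A : {set U}) : density A <= 1.
Proof.
have [U0|U0] := posnP #|U|; first by rewrite /density U0 invr0 mulr0.
by rewrite ler_pdivrMr ?ltr0n // mul1r ler_nat max_card.
Qed.

(** With the children fixed, [g] injects the product of the two clusters into the edges that could
    link them, so at least [#|V| ^ 2 / 64] independent edges must all be closed. *)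
Lemma unlinked_le (c : {ffun 'I_L -> W}) (i j : 'I_L) : (i < j)%N ->
  large (C (c i)) -> large (C (c j)) ->
  Ex (prodm (bern p)) (fun h => (~~ linked C (c, h) i j)%:R) <= b.
Proof.
move=> ij bi bj.
pose F := [set e : sib V | [&& (val e).1.1 == i, (val e).2.1 == j,
     (val e).1.2 \in C (c i) & (val e).2.2 \in C (c j)]].
have -> : Ex (prodm (bern p)) (fun h => (~~ linked C (c, h) i j)%:R) =
   Ex (prodm (bern p)) (fun h => (~~ [exists e, (e \in F) && h e])%:R).
  apply: eq_Ex => h; congr (_%:R); congr (nat_of_bool (~~ _)).
  by apply: eq_existsb => e; rewrite inE /= -!andbA.
rewrite Ex_bern_closed //; apply: pb.
pose g (x : V * V) : sib V := Sub ((i, x.1), (j, x.2)) ij.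
have gF : g @: setX (C (c i)) (C (c j)) \subset F.
  apply/subsetP => _ /imsetP[[u v] /setXP[/= ui vj] ->].
  by rewrite inE /= !eqxx ui vj.
have ginj : injective g.
  by move=> [u v] [u' v'] /(congr1 val) /= [-> ->].
have := subset_leq_card gF; rewrite card_imset // cardsX => leF.
move: bi bj; rewrite /large => bi bj.
apply: (@leq_trans (64 * (#|C (c i)| * #|C (c j)|))%N); last by rewrite leq_mul2l.
by rewrite expnS expn1 (_ : 64 = 8 * 8)%N // mulnACA leq_mul.
Qed.

Local Notation beta := (L%:R ^+ 2 * b).

(** [b] dominates a power of [1 - p]; the exponent [#|V| ^ 2] is one to which [pb] applies. *)
Lemma edge_bound_ge0 : 0 <= b.
Proof.
apply: le_trans (pb (_ : (_ <= 64 * #|V| ^ 2)%N)); last by lia.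
by apply: exprn_ge0; case/andP: p01 => _ ?; lra.
Qed.

(** Union bound over pairs of children, averaging the edges first with the children held fixed. *)
Lemma not_all_linked_le : Ex mm (fun w => (~~ all_linked C w)%:R) <= beta.
Proof.
pose bad (i j : 'I_L) (w : step_space W V) : R := ([&& (i < j)%N, large (C (w.1 i)),
  large (C (w.1 j)) & ~~ linked C w i j])%:R.
have bad0 i j w : 0 <= bad i j w by exact: ler0n.
apply: le_trans (le_Ex _ (_ : forall w, _ <= \sum_i \sum_j bad i j w)) _.
- exact: step_prob.
- move=> w; case: (boolP (all_linked C w)) => [_|]; last first.
    move=> /forallPn[i /forallPn[j]]; rewrite negb_imply => /andP[/and3P[ij bi bj] nl].
    rewrite (bigD1 i) //= (bigD1 j) //= {1}/bad ij bi bj nl /= -addrA lerDl.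
    by apply: addr_ge0; do ?[apply: sumr_ge0 => ? _].
  by do ?[apply: sumr_ge0 => ? _].
rewrite Ex_sum; under eq_bigr do rewrite Ex_sum.
apply: (@le_trans _ _ (\sum_(i < L) \sum_(j < L) b)); last first.
  by rewrite !sumr_const !card_ord -mulrnA -natrX mulr_natl.
apply: ler_sum => i _; apply: ler_sum => j _.
rewrite Ex_pair -[leRHS](Ex_const b (prodm_prob 'I_L mP)).
apply: le_Ex; first exact: prodm_prob.
move=> c; rewrite /bad /=.
have [h|nh] := boolP [&& (i < j)%N, large (C (c i)) & large (C (c j))].
  case/and3P: h => ij bi bj; rewrite ij bi bj /=; exact: unlinked_le.
rewrite (@eq_Ex _ _ _ _ (fun=> 0)) ?Ex_const ?edge_bound_ge0 //.
- exact: prodm_prob (bern_prob p01).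
- by move=> h; move: nh; rewrite !andbA => /negPf ->.
Qed.

(** [Wt] is the density of a child after a sparse cluster is discarded; [avg] below is the density
    of the merge before the linking condition is imposed. *)
Let Wt w : R := if large (C w) then X w else 0.

Let avg (w : step_space W V) : R := L%:R^-1 * \sum_i Wt (w.1 i).

Lemma Wt01 w : 0 <= Wt w <= 1.
Proof. by rewrite /Wt; case: ifP; rewrite ?density_ge0 ?density_le1 ?lexx ?ler01. Qed.

Lemma avg01 w : 0 <= avg w <= 1.
Proof.
rewrite /avg mulr_ge0 ?invr_ge0 ?sumr_ge0 //=; last first.
  by move=> i _; case/andP: (Wt01 (w.1 i)).
rewrite mulrC ler_pdivrMr ?ltr0n // mul1r -[leRHS]/(L%:R).
rewrite -[X in X%:R](card_ord L) -sumr_const; apply: ler_sum => i _.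
by case/andP: (Wt01 (w.1 i)).
Qed.

Lemma density_merge w : X' w = if all_linked C w then avg w else 0.
Proof.
rewrite /merged /density; case: ifP => _; last by rewrite cards0 mul0r.
rewrite /avg card_prod card_ord natrM invfM mulrCA; congr (_ * _).
rewrite -sum1_card natr_sum.
have -> : \sum_(x in [set x | large (C (w.1 x.1)) && (x.2 \in C (w.1 x.1))]) (1%:R : R)
   = \sum_i \sum_(u | large (C (w.1 i)) && (u \in C (w.1 i))) 1.
  rewrite pair_big_dep /=; apply: eq_bigl => x; by rewrite inE.
rewrite mulr_suml; apply: eq_bigr => i _; rewrite /Wt.
case: ifP => bi /=; last by rewrite big_pred0 ?mul0r.
by rewrite sumr_const.
Qed.

Hypothesis E34 : 3 / 4 <= E.

(** Chebyshev: a sparse cluster deviates from the mean by at least 3/4 - 1/8 = 5/8, and 3 * (5/8)^2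
    exceeds 1. *)
Lemma small_prob_le : Ex m (fun w => (~~ large (C w))%:R) <= 3 * Var.
Proof.
rewrite -ExZ; apply: le_Ex => // w.
have [_|] := boolP (large (C w)); first by rewrite mulr_ge0 ?sqr_ge0.
rewrite large_density -ltNge /= => h.
have h1 : 5 / 8 <= E - density (C w) by have := E34; lra.
rewrite -sqrrN opprB.
have : 5 / 8 * (5 / 8) <= (E - density (C w)) ^+ 2 by rewrite expr2 ler_pM //; lra.
lra.
Qed.

Lemma E_le1 : E <= 1.
Proof. by rewrite -[leRHS](Ex_const 1 mP); apply: le_Ex => // w; exact: density_le1. Qed.

Lemma Var_ge0 : 0 <= Var.
Proof. by rewrite -[leLHS](Ex_const 0 mP); apply: le_Ex => // w; exact: sqr_ge0. Qed.

(** Discarding a sparse cluster costs at most 1/8 of density, hence at most 3/8 of the variance on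
    average. *)
Lemma ExWt_ge : E - Var <= Ex m Wt.
Proof.
rewrite -subr_ge0.
have : Ex m (fun w => X w - Wt w) <= Ex m (fun w => 1 / 8 * (~~ large (C w))%:R).
  apply: le_Ex => // w; rewrite /Wt; case: ifPn => h /=; first by rewrite subrr mulr0.
  by rewrite subr0 mulr1; rewrite large_density -ltNge in h; exact: ltW.
rewrite ExZ ExB; have := small_prob_le; have := Var_ge0; lra.
Qed.

(* Since [E >= 3/4], replacing [X < 1/8] by 0 multiplies the deviation from [E]
   by at most [E / (E - 1/8) <= 6/5], and [(6/5)^2 < 3/2]; averaging over at least
   two independent children then leaves a factor [3/4]. *)
Lemma VarWt_le : Ex m (fun w => (Wt w - Ex m Wt) ^+ 2) <= 3 / 2 * Var.
Proof.
apply: le_trans (Ex_bias_var _ E mP) _.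
rewrite -ExZ; apply: le_Ex => // w; rewrite /Wt.
have h0 := sqr_ge0 (X w - E).
case: ifPn => h; first by lra.
rewrite large_density -ltNge in h.
have h1 := E_le1; have h2 := E34.
set x := density _ in h h0 *; have : 5 / 6 * E <= E - x by lra.
by move=> h3; nra.
Qed.

Lemma Ex_avg : Ex mm avg = Ex m Wt.
Proof.
rewrite (Ex_step1 (fun c => L%:R^-1 * \sum_i Wt (c i))) ExZ Ex_sum.
under eq_bigr do rewrite Ex_coord //.
by rewrite sumr_const card_ord -[X in _ * X]mulr_natl mulKf // pnatr_eq0.
Qed.

(** A failed link loses at most [avg <= 1], so pointwise the new density is at least [avg] minus the
    failure indicator. *)
Lemma mean_step : E - Var - beta <= Ex mm X'.
Proof.
have : Ex mm (fun w => avg w - (~~ all_linked C w)%:R) <= Ex mm X'.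
  apply: le_Ex; first exact: step_prob.
  move=> w; rewrite density_merge; case: ifP => _ /=; first by rewrite subr0.
  by rewrite subr_le0; case/andP: (avg01 w).
rewrite ExB Ex_avg; have := ExWt_ge; have := not_all_linked_le; lra.
Qed.

(** Centred at the mean of [Wt], the deviation is that of [avg] when all links succeed; otherwise
    its square is at most 1 and is charged to the failure indicator. *)
Lemma var_step : Ex mm (fun w => (X' w - Ex mm X') ^+ 2) <= 3 / 4 * Var + beta.
Proof.
apply: le_trans (Ex_bias_var _ (Ex m Wt) step_prob) _.
apply: (@le_trans _ _
  (Ex mm (fun w => (avg w - Ex m Wt) ^+ 2 + (~~ all_linked C w)%:R))).
  apply: le_Ex; first exact: step_prob.
  move=> w; rewrite density_merge; case: ifP => _ /=; first by rewrite addr0.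
  have h0 : 0 <= Ex m Wt <= 1.
    rewrite -[X in X <= _ <= _](Ex_const 0 mP) -[X in _ <= _ <= X](Ex_const 1 mP).
    by rewrite !le_Ex // => u; case/andP: (Wt01 u).
  have := sqr_ge0 (avg w - Ex m Wt); case/andP: h0 => h0 h1; nra.
rewrite ExD lerD ?not_all_linked_le //.
rewrite (Ex_step1 (fun c => (L%:R^-1 * (\sum_i Wt (c i)) - Ex m Wt) ^+ 2)).
rewrite Ex_var_avg //.
have L2 : L%:R^-1 <= 2^-1 :> R by rewrite lef_pV2 ?posrE ?ltr0n // ler_nat.
apply: le_trans (ler_wpM2l _ VarWt_le) _; first by rewrite invr_ge0.
have := Var_ge0 => v0.
by apply: le_trans (ler_wpM2r _ L2) _; lra.
Qed.

Definition all_merge (w : step_space W V) : bool :=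
  all_linked C w && [forall i, large (C (w.1 i))].

(** Union bound over three failures: [v] misses its child cluster, one of the [L] children is
    sparse, or a link is missing. *)
Lemma all_merge_step (v : V) (i0 : 'I_L) :
  Ex m (fun w => (v \in C w)%:R) - 3 * L%:R * Var - beta <=
  Ex mm (fun w => ((v \in C (w.1 i0)) && all_merge w)%:R).
Proof.
have : Ex mm (fun w => (v \in C (w.1 i0))%:R - \sum_i (~~ large (C (w.1 i)))%:R
     - (~~ all_linked C w)%:R) <=
  Ex mm (fun w => ((v \in C (w.1 i0)) && all_merge w)%:R).
  apply: le_Ex; first exact: step_prob.
  move=> w; rewrite /all_merge; set s := \sum_i _.
  have s0 : 0 <= s by apply: sumr_ge0 => i _; rewrite ler0n.
  have [ag|/forallPn[i nb]] := boolP [forall i, large (C (w.1 i))].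
    case: (_ \in _); case: (all_linked _ _) => /=; lra.
  have : 1 <= s.
    rewrite /s (bigD1 i) //= nb lerDl; apply: sumr_ge0 => j _; rewrite ler0n //.
  case: (_ \in _); case: (all_linked _ _) => /=; lra.
rewrite !ExB (Ex_step1 (fun c => (v \in C (c i0))%:R)).
rewrite (Ex_coord _ (fun u => (v \in C u)%:R)) //.
rewrite (Ex_step1 (fun c => \sum_i (~~ large (C (c i)))%:R)) Ex_sum.
under eq_bigr do rewrite (Ex_coord _ (fun u => (~~ large (C u))%:R)) //.
rewrite sumr_const card_ord -mulr_natl.
have := ler_wpM2l (ler0n R L) small_prob_le; have := not_all_linked_le; lra.
Qed.

Lemma origin_step (v : V) (i0 : 'I_L) :
  Ex m (fun w => (v \in C w)%:R) - 3 * L%:R * Var - beta <=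
  Ex mm (fun w => ((i0, v) \in merged C w)%:R).
Proof.
apply: le_trans (all_merge_step v i0) _; apply: le_Ex; first exact: step_prob.
move=> w; rewrite /all_merge /merged ler_nat.
case: (all_linked C w); rewrite ?andbF //= inE /=.
case: (v \in _) => //=; case: forallP => // bw.
by rewrite bw.
Qed.

End OneStep.
End MergeStep.

(** * Iterating over scales *)

Section Iteration.
Variables (R : realFieldType) (l : nat).
Local Notation L := l.+2.

(* The first component is the coordinate of highest index. *)
Fixpoint vtx (k : nat) : finType :=
  if k is j.+1 then ('I_L * vtx j)%type else unit.

Fixpoint conf (k : nat) : finType :=
  if k is j.+1 then step_space l (conf j) (vtx j) else bool.

Fixpoint block_cluster (k : nat) : conf k -> {set vtx k} :=
  match k with
  | 0 => fun b => if b then setT else set0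
  | j.+1 => @merged l (conf j) (vtx j) (@block_cluster j)
  end.

Fixpoint vtx0 (k : nat) : vtx k :=
  match k with 0 => tt | j.+1 => (ord0, vtx0 j) end.

Variables (q : R) (p b : nat -> R).

Fixpoint weight (k : nat) : conf k -> R :=
  match k with
  | 0 => bern q
  | j.+1 => step_weight (@weight j) (p j)
  end.

Lemma card_vtx k : #|vtx k| = (L ^ k)%N.
Proof.
elim: k => [|k IH] /=; first by rewrite card_unit.
by rewrite card_prod card_ord IH expnS.
Qed.

Hypothesis q01 : 0 <= q <= 1.
Hypothesis p01 : forall k, 0 <= p k <= 1.

Lemma weight_prob k : is_prob (@weight k).
Proof.
elim: k => [|k IH] /=; first exact: bern_prob.
exact: step_prob.
Qed.

Hypothesis pb : forall k n, ((L ^ k) ^ 2 <= 64 * n)%N -> (1 - p k) ^+ n <= b k.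
Hypothesis q_near1 : L%:R * (1 - q) <= 1 / 100.
Hypothesis b_sum : forall n, L%:R * \sum_(k < n) L%:R ^+ 2 * b k <= 1 / 100.

Let mean k := Ex (@weight k) (fun w => density R (block_cluster w)).
Let var k := Ex (@weight k) (fun w => (density R (block_cluster w) - mean k) ^+ 2).
Let origin k := Ex (@weight k) (fun w => (vtx0 k \in block_cluster w)%:R).

Let vtx_gt0 k : (0 < #|vtx k|)%N.
Proof. by rewrite card_vtx expn_gt0. Qed.

Let pb' k n : (#|vtx k| ^ 2 <= 64 * n)%N -> (1 - p k) ^+ n <= b k.
Proof. rewrite card_vtx; exact: pb. Qed.

Let var_ge0 k : 0 <= var k.
Proof. exact: Var_ge0 (weight_prob k). Qed.

Lemma base_values : [/\ mean 0 = q, var 0 = q * (1 - q) & origin 0 = q].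
Proof.
have d1 : density R [set: unit] = 1 by rewrite /density cardsT card_unit divr1.
have d0 : density R (set0 : {set unit}) = 0 by rewrite /density cards0 mul0r.
have m0 : mean 0 = q by rewrite /mean /Ex big_bool /= d1 d0; ring.
split=> //; first by rewrite /var m0 /Ex big_bool /= d1 d0; ring.
by rewrite /origin /Ex big_bool /= inE in_set0 /= mulr1 mulr0 addr0.
Qed.

(* [mean - 4 var] and [origin - 12 L var] are potentials: the variance lost by
   contraction pays for the clusters dropped at each step. *)
Lemma iterate k :
  let s := \sum_(j < k) L%:R ^+ 2 * b j in
  [/\ q - 4 * (1 - q) - 5 * s <= mean k - 4 * var k
    & q - 12 * L%:R * (1 - q) - (1 + 12 * L%:R) * s
        <= origin k - 12 * L%:R * var k].
Proof.
have Lge2 : 2 <= L%:R :> R by rewrite ler_nat.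
case/andP: q01 => q0 q1; have qn := q_near1.
elim: k => [|k IH] /=.
  have [-> -> ->] := base_values; rewrite big_ord0.
  have h1 : q * (1 - q) <= 1 - q by nra.
  have h2 : L%:R * (q * (1 - q)) <= L%:R * (1 - q) by apply: ler_wpM2l.
  by split; lra.
rewrite big_ord_recr /=; set s := \sum_(j < k) _ in IH *.
have h := b_sum k; rewrite -/s in h.
(* Here [1 - q <= 1/200] and [s <= 1/200], so the potential of the mean is at least 1 - 5/200 -
   5/200, well above 3/4. *)
have m34 : 3 / 4 <= mean k.
  have h1 : 2 * (1 - q) <= L%:R * (1 - q) by apply: ler_wpM2r; lra.
  have [s0|s0] := leP s 0; first by case: IH => + _; have := var_ge0 k; lra.
  have h2 : 2 * s <= L%:R * s by apply: ler_wpM2r; lra.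
  by case: IH => + _; have := var_ge0 k; lra.
have vP := weight_prob k.
have hm : mean k - var k - L%:R ^+ 2 * b k <= mean k.+1.
  exact: (mean_step (C := @block_cluster k) l vP (p01 k) (vtx_gt0 k) (@pb' k) m34).
have hv : var k.+1 <= 3 / 4 * var k + L%:R ^+ 2 * b k.
  exact: (var_step (C := @block_cluster k) l vP (p01 k) (vtx_gt0 k) (@pb' k) m34).
have ho : origin k - 3 * L%:R * var k - L%:R ^+ 2 * b k <= origin k.+1.
  exact: (origin_step (C := @block_cluster k) vP (p01 k) (vtx_gt0 k)
    (@pb' k) m34 (vtx0 k) ord0).
have hL := ler_wpM2l (ler0n R L) hv.
(* The potentials balance because 1 + 4 * 3/4 = 4 and 3 + 12 * 3/4 = 12: the variance cancels and
   only multiples of [bb] are lost. *)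
set bb := L%:R ^+ 2 * b k in hm hv ho hL *.
case: IH => i1 i2; split; lra.
Qed.

(** The potential of [origin] absorbs the term [3 * L * var]. The remaining losses, of order
    [L * (1 - q)] and [L * s], are at most 1/100 times 12 each, plus small terms, which leaves more
    than 1/2. *)
Lemma all_merge_prob k : 1 / 2 <= Ex (@weight k.+1)
  (fun w => ((vtx0 k \in block_cluster (w.1 ord0)) && all_merge (@block_cluster k) w)%:R).
Proof.
have Lge2 : 2 <= L%:R :> R by rewrite ler_nat.
case/andP: q01 => q0 q1; have qn := q_near1.
have [i1 i2] := iterate k.
set s := \sum_(j < k) _ in i1 i2.
have h := b_sum k; rewrite -/s in h.
have h' := b_sum k.+1; rewrite big_ord_recr /= -/s mulrDr in h'.
have h1 : 2 * (1 - q) <= L%:R * (1 - q) by apply: ler_wpM2r; lra.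
have s_ge0 n : 0 <= \sum_(j < n) L%:R ^+ 2 * b j.
  apply: sumr_ge0 => j _; rewrite mulr_ge0 ?exprn_ge0 ?ler0n //.
  exact: (edge_bound_ge0 (p01 j) (vtx_gt0 j) (@pb' j)).
have s0 : 0 <= s := s_ge0 k.
have b0 : 0 <= L%:R ^+ 2 * b k.
  rewrite mulr_ge0 ?exprn_ge0 ?ler0n //.
  exact: (edge_bound_ge0 (p01 k) (vtx_gt0 k) (@pb' k)).
have h2 : 2 * s <= L%:R * s by apply: ler_wpM2r; lra.
have h3 : 2 * (L%:R ^+ 2 * b k) <= L%:R * (L%:R ^+ 2 * b k) by apply: ler_wpM2r; lra.
have h4 : 0 <= L%:R * var k by rewrite mulr_ge0 ?ler0n // var_ge0.
have m34 : 3 / 4 <= mean k by have := var_ge0 k; lra.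
apply: le_trans (all_merge_step (C := @block_cluster k) (weight_prob k) (p01 k)
  (vtx_gt0 k) (@pb' k) m34 (vtx0 k) ord0).
rewrite -/(var k) -/(origin k).
set bb := L%:R ^+ 2 * b k in h' b0 h3 *.
lra.
Qed.

End Iteration.

From mathcomp Require Import all_classical all_reals all_analysis.
From Stdlib Require Import Relation_Operators Operators_Properties.
Local Open Scope classical_set_scope.
Local Open Scope ring_scope.

(** * Observing a block of the hierarchical lattice *)

Lemma HL_ext (L : nat) (x y : HL L) :
  (forall i, sval x i = sval y i) -> x = y.
Proof.
case: x y => [x hx] [y hy] /= /funext xy; subst y.
by congr exist; exact: Prop_irrelevance.
Qed.

Section Embedding.
Variable l : nat.
Local Notation L := l.+2.

Lemma upd_subproof (x : HL L) (k : nat) (i : 'I_L) :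
  (forall n, ((if n == k then val i else sval x n) < L)%N) /\
  exists N, forall n, (N <= n)%N -> (if n == k then val i else sval x n) = 0%N.
Proof.
case: x => x [xL [N xN]] /=; split=> [n|]; first by case: ifP.
exists (maxn N k.+1) => n; rewrite geq_max => /andP[Nn kn].
by rewrite gtn_eqF // xN.
Qed.

Definition upd (x : HL L) k i : HL L := exist _ _ (upd_subproof x k i).

(** The block of level [k] around [x]: indices from [k] on are inherited from [x], those below [k]
    are overwritten by the tree address [v]. *)
Fixpoint emb (k : nat) (x : HL L) : vtx l k -> HL L :=
  match k with
  | 0 => fun=> x
  | j.+1 => fun v => emb (upd x j v.1) v.2
  end.

Lemma emb_high k x (v : vtx l k) n :
  (k <= n)%N -> sval (emb x v) n = sval x n.
Proof.
elim: k x v => [//|k IH] x v kn /=.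
by rewrite IH ?(ltnW kn) //= gtn_eqF.
Qed.

Lemma emb_coord k x (v : vtx l k.+1) : sval (emb x v) k = v.1.
Proof. by rewrite /= emb_high //= eqxx. Qed.

Lemma emb_inj k x : injective (@emb k x).
Proof.
elim: k x => [|k IH] x; first by move=> [] [].
move=> [i u] [j v] e.
have ij : i = j.
  apply: val_inj; rewrite /= -(emb_coord x ((i, u) : vtx l k.+1)).
  by rewrite e emb_coord.
by subst j; move: e => /= /IH ->.
Qed.

Lemma emb_vtx0 k x : (forall i, sval x i = 0%N) -> emb x (vtx0 l k) = x.
Proof.
elim: k x => [//|k IH] x x0 /=.
have -> : upd x k ord0 = x.
  by apply: HL_ext => i /=; case: eqP => // _; rewrite x0.
exact: IH.
Qed.

Lemma sib_neq k x (e : sib l (vtx l k)) :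
  @emb k.+1 x (val e).1 <> @emb k.+1 x (val e).2.
Proof.
by move/emb_inj => h; have := valP e; rewrite /= h ltnn.
Qed.

Lemma edge_subproof (u v : HL L) : u <> v ->
  exists x y : HL L, x <> y /\ [set u; v] = [set x; y].
Proof. by move=> uv; exists u, v. Qed.

Definition mkE (u v : HL L) (uv : u <> v) : HEdge L :=
  exist _ _ (edge_subproof uv).

Definition edge k x (e : sib l (vtx l k)) : HEdge L := mkE (@sib_neq k x e).

Lemma HEdge_ext (e f : HEdge L) : sval e = sval f -> e = f.
Proof.
case: e f => [e he] [f hf] /= ef; subst f.
by congr exist; exact: Prop_irrelevance.
Qed.

Lemma level_agree (x y : HL L) k : (forall i, (k.+1 <= i)%N -> sval x i = sval y i) ->
  sval x k <> sval y k -> level x y = k.+1.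
Proof.
move=> hi neq; rewrite /level.
have uniq m n (P : nat -> Prop) : (P m /\ forall i, P i -> (m <= i)%N) ->
    (P n /\ forall i, P i -> (n <= i)%N) -> m = n.
  by move=> [Pm mm] [Pn mn]; apply/eqP; rewrite eqn_leq mm // mn.
case: xgetP => [n _ /= hn|/(_ k.+1)]; last first.
  case; split=> // m hm; rewrite ltnNge; apply/negP => mk; exact: neq (hm _ mk).
apply: uniq hn _; split=> // m hm; rewrite ltnNge; apply/negP => mk.
exact: neq (hm _ mk).
Qed.

(** Siblings differ at index [k], which is coordinate [k.+1] in the 1-indexed norm. Hence the edges
    drawn at merge step [k] carry the kernel value of level [k.+1]. *)
Lemma level_sib k x (e : sib l (vtx l k)) :
  level (@emb k.+1 x (val e).1) (@emb k.+1 x (val e).2) = k.+1.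
Proof.
apply: level_agree => [i ki|]; first by rewrite !emb_high.
by rewrite !emb_coord => h; have := valP e; rewrite h ltnn.
Qed.

Lemma level_sym (x y : HL L) : level x y = level y x.
Proof.
have H (u v : HL L) : [set n : nat | (forall i, (n <= i)%N -> sval u i = sval v i) /\
     forall m : nat, (forall i, (m <= i)%N -> sval u i = sval v i) -> (n <= m)%N]
  `<=` [set n : nat | (forall i, (n <= i)%N -> sval v i = sval u i) /\
     forall m : nat, (forall i, (m <= i)%N -> sval v i = sval u i) -> (n <= m)%N].
  move=> n /= [h1 h2]; split=> [i ni|m hm]; first by rewrite h1.
  by apply: h2 => i mi; rewrite hm.
by rewrite /level; congr xget; apply/seteqP; split; exact: H.
Qed.

Section Observation.
Variable T : Type.
Variable om : HL L -> T -> bool.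
Variable eta : HEdge L -> T -> bool.

(** The bridge between the infinite graph and the finite model: it reads off the states inside one
    block in the format of [conf]. *)
Fixpoint obs (k : nat) (x : HL L) (w : T) : conf l k :=
  match k with
  | 0 => om x w
  | j.+1 => ([ffun i => obs j (upd x j i) w], [ffun e => eta (edge x e) w])
  end.

Lemma open_adj_sym w u v : open_adj om eta w u v -> open_adj om eta w v u.
Proof.
case=> uv [ou [ov [e [he eo]]]]; split; first exact: nesym.
by do 3?split => //; exists e; rewrite he setUC.
Qed.

Lemma connected_sym w u v : clos_refl_trans _ (open_adj om eta w) u v ->
  clos_refl_trans _ (open_adj om eta w) v u.
Proof.
elim=> [a c /open_adj_sym|a|a c d _ h1 _ h2]; first exact: rt_step.
  exact: rt_refl.
exact: rt_trans h2 h1.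
Qed.

Lemma cluster_open k x w (v : vtx l k) :
  v \in block_cluster (obs k x w) -> om (emb x v) w.
Proof.
elim: k x v => [|k IH] x v /=; first by case: (om x w) => //; rewrite inE.
rewrite /merged; case: ifP => _; last by rewrite inE.
by rewrite inE => /andP[_]; rewrite ffunE; exact: IH.
Qed.

Lemma cluster_connected k x w (u v : vtx l k) :
  u \in block_cluster (obs k x w) -> v \in block_cluster (obs k x w) ->
  clos_refl_trans _ (open_adj om eta w) (emb x u) (emb x v).
Proof.
elim: k x u v => [|k IH] x u v /=; first by move=> _ _; exact: rt_refl.
rewrite /merged; case: ifP => [gd|_]; last by rewrite inE.
(* Linking edges are stored with the smaller child index first; equal indices fall back on the
   induction hypothesis. *)
rewrite !inE; wlog lt_uv : u v / (u.1 < v.1)%N.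
  move=> H Hu Hv; have [h|h|h] := ltngtP u.1 v.1.
  - exact: H.
  - by apply: connected_sym; exact: H.
  move: u v h Hu Hv => [i u] [j v] /= /val_inj ij; subst j.
  by move=> /andP[_]; rewrite ffunE => Hu /andP[_ Hv]; exact: IH.
case/andP=> bu Cu /andP[bv Cv].
move/forallP: gd => /(_ u.1)/forallP/(_ v.1); rewrite lt_uv bu bv /=.
case/existsP=> e /and5P[/eqP e1 /eqP e2 C1 C2 eo].
rewrite /= !ffunE in Cu Cv C1 C2 eo.
have eadj : open_adj om eta w (emb (upd x k u.1) (val e).1.2)
                              (emb (upd x k v.1) (val e).2.2).
  split; first by rewrite -e1 -e2; exact: (@sib_neq k x e).
  split; first exact: cluster_open C1.
  split; first exact: cluster_open C2.
  by exists (edge x e); split => //; rewrite -e1 -e2.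
apply: rt_trans (IH _ _ _ Cu C1) _.
apply: rt_trans (rt_step _ _ _ _ eadj) _.
exact: IH C2 Cv.
Qed.

(* The cluster of [o] reaches the sibling block with coordinate 1 at index [k]. *)
Lemma all_merge_escape k o w : (forall i, sval o i = 0%N) ->
  vtx0 l k \in block_cluster ((obs k.+1 o w).1 ord0) ->
  all_merge (@block_cluster l k) (obs k.+1 o w) ->
  exists2 y, open_cluster om eta o w y & sval y k <> 0%N.
Proof.
move=> o0 C0 /andP[gd /forallP bg].
have /card_gt0P[v Cv] : (0 < #|block_cluster ((obs k.+1 o w).1 (inord 1))|)%N.
  rewrite lt0n; apply/negP => /eqP h0; move: (bg (inord 1)).
  by rewrite /large card_vtx h0 muln0 leqn0 expn_eq0.
pose v0 : vtx l k.+1 := vtx0 l k.+1.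
pose v1 : vtx l k.+1 := (inord 1, v).
have m0 : v0 \in block_cluster (obs k.+1 o w).
  by move: C0; rewrite /= /merged gd inE bg.
have m1 : v1 \in block_cluster (obs k.+1 o w).
  by rewrite /= /merged gd inE bg.
have e0 : emb o v0 = o by exact: emb_vtx0.
exists (emb o v1); last by rewrite emb_coord /= inordK.
split; first by rewrite -{1}e0; exact: cluster_open m0.
by rewrite -{1}e0; exact: cluster_connected.
Qed.

End Observation.

(** A flat list of the vertices and edges of a block. Independence is stated for injective families
    of states, so the nested configuration has to be unfolded into single bits. *)
Fixpoint idx (k : nat) : finType :=
  if k is j.+1 then (('I_L * idx j) + sib l (vtx l j))%type : finType
  else unit.

Fixpoint idxv (k : nat) (x : HL L) : idx k -> HL L + HEdge L :=
  match k with
  | 0 => fun=> inl x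
  | j.+1 => fun t => match t with
    | inl s => @idxv j (upd x j s.1) s.2
    | inr e => inr (edge x e)
    end
  end.

Fixpoint bits (k : nat) : conf l k -> idx k -> bool :=
  match k with
  | 0 => fun b _ => b
  | j.+1 => fun c t => match t with
    | inl s => @bits j (c.1 s.1) s.2
    | inr e => c.2 e
    end
  end.

Lemma obs_bits (T : Type) om eta k x (w : T) (c : conf l k) :
  obs om eta k x w = c <->
  forall t, match @idxv k x t with inl v => om v | inr e => eta e end w
    = bits c t.
Proof.
elim: k x c => [|k IH] x c /=; first by split=> [-> //|/(_ tt)].
case: c => c h /=; split.
  move=> [<- <-] [[i t]|e] /=; rewrite ffunE //.
  exact: (proj1 (IH _ _) erefl).
move=> H; congr pair; apply/ffunP => i; rewrite ffunE.
  by apply/IH => t; exact: (H (inl (i, t))).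
exact: (H (inr i)).
Qed.

(* Distinct children have disjoint vertex sets, hence [idxv] is injective. *)
Definition endpoints (s : HL L + HEdge L) : set (HL L) :=
  match s with inl v => [set v] | inr e => sval e end.

Lemma endpoints_idxv k x t y n : (k <= n)%N ->
  endpoints (@idxv k x t) y -> sval y n = sval x n.
Proof.
elim: k x t => [|k IH] x; first by move=> t _ ->.
move=> [[i t]|e] kn /=.
  by move/(IH _ _ (ltnW kn)) => -> /=; rewrite gtn_eqF.
case=> ->; first exact: (@emb_high k.+1 x (val e).1).
exact: (@emb_high k.+1 x (val e).2).
Qed.

Lemma endpoints_nonempty s : exists y, endpoints s y.
Proof.
case: s => [v|[e he]] /=; first by exists v.
by have [u [v [_ ->]]] := he; exists u; left.
Qed.

Lemma idxv_inj k x : injective (@idxv k x).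
Proof.
elim: k x => [|k IH] x; first by move=> [] [].
(* All endpoints of a state inside a child share their value at index [k], while a linking edge has
   two different values there. *)
have mixed i t (e : sib l (vtx l k)) : @idxv k (upd x k i) t <> inr (edge x e).
  move=> h.
  have h1 : endpoints (@idxv k (upd x k i) t) (@emb k.+1 x (val e).1).
    by rewrite h; left.
  have h2 : endpoints (@idxv k (upd x k i) t) (@emb k.+1 x (val e).2).
    by rewrite h; right.
  have := endpoints_idxv (leqnn k) h1; have := endpoints_idxv (leqnn k) h2.
  rewrite !emb_coord => <- /val_inj h3.
  by have := valP e; rewrite h3 ltnn.
move=> [[i t]|e] [[j s]|f] //=.
- move=> h; have [y hy] := endpoints_nonempty (@idxv k (upd x k i) t).
  have ij : i = j.
    apply: val_inj; have := endpoints_idxv (leqnn k) hy.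
    by rewrite h in hy; rewrite (endpoints_idxv (leqnn k) hy) /= eqxx => ->.
  by subst j; rewrite (IH _ _ _ h).
- by move/mixed.
- by move/esym/mixed.
case=> h; congr inr; apply: val_inj.
have h1 : [set @emb k.+1 x (val f).1; @emb k.+1 x (val f).2] (@emb k.+1 x (val e).1).
  by rewrite -[[set _; _]]h; left.
have h2 : [set @emb k.+1 x (val f).1; @emb k.+1 x (val f).2] (@emb k.+1 x (val e).2).
  by rewrite -[[set _; _]]h; right.
have le := valP e; have lf := valP f; move: le lf h1 h2.
case: (val e) => u v; case: (val f) => u' v' /= le lf.
have ei (a b : vtx l k.+1) : emb (upd x k a.1) a.2 = emb (upd x k b.1) b.2 ->
  a = b by exact: (@emb_inj k.+1 x a b).
(* Of the four ways to match endpoints of equal edges, the order of the child indices leaves only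
   the identity. *)
move=> [] /ei hu [] /ei hv; subst; rewrite ?ltnn // in le lf *.
by move: (ltn_trans le lf); rewrite ltnn.
Qed.

End Embedding.

(** * Countability of the lattice and its finite subsets *)

Definition HL_size (L : nat) (x : HL L) : nat := sval (cid (proj2 (svalP x))).

Lemma HL_size_out (L : nat) (x : HL L) i : (HL_size x <= i)%N -> sval x i = 0%N.
Proof. exact: (svalP (cid (proj2 (svalP x)))). Qed.

(** A vertex is coded by its prefix up to a chosen bound of its support; the length of the prefix
    recovers that bound. *)
Lemma HL_countable (L : nat) : countable [set: HL L].
Proof.
apply/countable_injP.
exists (fun x => pickle (mkseq (sval x) (HL_size x))).
move=> x y _ _ /(pcan_inj pickleK) e.
have eN : HL_size x = HL_size y.
  by have := congr1 size e; rewrite !size_mkseq.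
apply: HL_ext => i; have [h|h] := leqP (HL_size x) i.
  by rewrite !HL_size_out -?eN.
by have := congr1 (fun s => nth 0%N s i) e; rewrite !nth_mkseq // -eN.
Qed.

Lemma HL_finite_bounded (L : nat) (A : set (HL L)) : finite_set A ->
  exists N, forall x i, A x -> (N <= i)%N -> sval x i = 0%N.
Proof.
move=> /(finite_image (@HL_size L)) /finite_seqP[s es].
exists (\max_(i <- s) i)%N => x i Ax hi; apply: HL_size_out; apply: leq_trans hi.
have : [set` s] (HL_size x) by rewrite -es; exists x.
by move=> /= Ns; exact: (@leq_bigmax_seq _ s xpredT (fun i => i) _ Ns).
Qed.

Lemma HL_bounded_finite (L : nat) (A : set (HL L)) N :
  (forall x i, A x -> (N <= i)%N -> sval x i = 0%N) -> finite_set A.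
Proof.
move=> hA; pose f (x : HL L) : {ffun 'I_N -> 'I_L} :=
  [ffun i : 'I_N => Ordinal (proj1 (svalP x) i)].
suff finj : {in A &, injective f}.
  by rewrite -(eq_finite_set (inj_card_eq finj)); exact: finite_finset.
move=> x y /set_mem Ax /set_mem Ay fxy; apply: HL_ext => i.
have [h|h] := leqP N i; first by rewrite !hA.
have /(congr1 val) := congr1 (fun g : {ffun 'I_N -> 'I_L} => g (Ordinal h)) fxy.
by rewrite !ffunE.
Qed.

(** * Law of the observed configuration *)

Section Law.
Variables (R : realType) (l : nat) (q : R) (p : nat -> R).
Local Notation L := l.+2.

Fixpoint idxp (k : nat) : idx l k -> R :=
  match k with
  | 0 => fun=> q
  | j.+1 => fun t => match t with
    | inl s => @idxp j s.2
    | inr _ => p j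
    end
  end.

Lemma weight_bits k (c : conf l k) :
  weight q p c = \prod_t bern (idxp t) (bits c t).
Proof.
elim: k c => [|k IH] c /=.
  by rewrite (big_pred1 tt) //; case.
rewrite /step_weight big_sumType /=; congr (_ * _).
rewrite -(pair_bigA _ (fun i t => bern (idxp t) (bits (c.1 i) t))) /=.
by apply: eq_bigr => i _; exact: IH.
Qed.

Variables (J : HL L -> HL L -> R) (j : nat -> R).
Hypothesis Jj : forall x y, x <> y -> J x y = j (level x y).
Hypothesis pj : forall k, p k = 1 - expR (- j k.+1).
Variables (d : measure_display) (T : measurableType d) (P : probability T R).
Variables (om : HL L -> T -> bool) (eta : HEdge L -> T -> bool).
Hypothesis PqJ : is_PqJ q J P om eta.

Let X (s : HL L + HEdge L) : T -> bool :=
  match s with inl v => om v | inr e => eta e end.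

Lemma state_measurable s b : measurable [set w | X s w = b].
Proof.
have [mo [me _]] := PqJ.
have H : measurable [set w | X s w = true] by case: s => [v|e]; [exact: mo | exact: me].
case: b => //; have -> : [set w | X s w = false] = ~` [set w | X s w = true].
  by apply/seteqP; split=> w /=; case: (X s w).
exact: measurableC.
Qed.

Lemma state_prob s b r : P [set w | X s w] = r%:E ->
  P [set w | X s w = b] = (bern r b)%:E.
Proof.
move=> h; case: b => //=.
have -> : [set w | X s w = false] = ~` [set w | X s w].
  by apply/seteqP; split=> w /=; case: (X s w).
rewrite probability_setC ?h //; exact: (state_measurable s true).
Qed.

Lemma idxv_prob k x (t : idx l k) b :
  P [set w | X (idxv x t) w = b] = (bern (idxp t) b)%:E.
Proof.
have [_ [_ [_ [po pe]]]] := PqJ.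
elim: k x t => [|k IH] x /=; first by move=> _; exact: (@state_prob (inl x) _ _ (po x)).
case=> [[i t]|e]; first exact: IH.
apply: (@state_prob (inr (edge x e))); rewrite /= pj -(level_sib x e) -Jj;
  last exact: sib_neq.
by apply: pe => //; exact: sib_neq.
Qed.

Lemma obs_eqE k x (c : conf l k) : [set w | obs om eta k x w = c] =
  \bigcap_(i in [set: 'I_#|idx l k|])
     [set w | X (idxv x (enum_val i)) w = bits c (enum_val i)].
Proof.
apply/seteqP; split=> w /=.
  by move/obs_bits => h i _; exact: h.
move=> h; apply/obs_bits => t.
by have := h (enum_rank t) I; rewrite /= enum_rankK.
Qed.

Lemma obs_measurable k x (c : conf l k) : measurable [set w | obs om eta k x w = c].
Proof.
rewrite obs_eqE; apply: fin_bigcap_measurable => [|i _]; first exact: finite_finset.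
exact: state_measurable.
Qed.

(** Injectivity of [idxv] lets mutual independence factor the event bit by bit, matching the product
    form of [weight]. *)
Lemma obs_law k x (c : conf l k) :
  P [set w | obs om eta k x w = c] = (weight q p c)%:E.
Proof.
have [_ [_ [ind _]]] := PqJ.
rewrite obs_eqE (ind _ (fun i => idxv x (enum_val i))).
  rewrite weight_bits (eq_bigr _ (fun i _ => idxv_prob x _ _)) prodEFin.
  by rewrite [in RHS](reindex _ (onW_bij _ (@enum_val_bij (idx l k)))).
by move=> a b /idxv_inj /enum_val_inj.
Qed.

Lemma obs_event k x (D : pred (conf l k)) :
  measurable [set w | D (obs om eta k x w)] /\
  P [set w | D (obs om eta k x w)] = (Ex (weight q p (k := k)) (fun c => (D c)%:R))%:E.
Proof.
have H (s : seq (conf l k)) : uniq s ->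
    measurable [set w | obs om eta k x w \in s] /\
    P [set w | obs om eta k x w \in s] = (\sum_(c <- s) weight q p c)%:E.
  elim: s => [_|c s IH /= /andP[cs /IH[ms Ps]]].
    have -> : [set w | obs om eta k x w \in [::]] = set0 by apply/seteqP; split.
    by rewrite measure0 big_nil; split; first exact: measurable0.
  have -> : [set w | obs om eta k x w \in c :: s] =
      [set w | obs om eta k x w = c] `|` [set w | obs om eta k x w \in s].
    apply/seteqP; split=> w /=; rewrite inE; first by case/predU1P; [left|right].
    by case=> [->|->]; rewrite ?eqxx ?orbT.
  have mc := obs_measurable x c; split; first exact: measurableU.
  rewrite measureU //; first by rewrite big_cons EFinD -Ps -(obs_law x).
  by apply/seteqP; split=> // w [/= ->]; rewrite (negPf cs).
have -> : [set w | D (obs om eta k x w)] =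
    [set w | obs om eta k x w \in [seq c <- enum (conf l k) | D c]].
  by apply/seteqP; split=> w /=; rewrite mem_filter mem_enum andbT.
have [m ->] := H _ (filter_uniq D (enum_uniq (conf l k))); split=> //.
congr _%:E; rewrite big_filter big_enum_cond /= /Ex big_mkcond.
by apply: eq_bigr => c _; case: (D c); rewrite ?mulr1 ?mulr0.
Qed.

End Law.

(** * The infinite cluster event *)

Section InfiniteCluster.
Variables (l : nat) (d : measure_display) (T : measurableType d).
Local Notation L := l.+2.
Variables (om : HL L -> T -> bool) (eta : HEdge L -> T -> bool).
Hypothesis om_measurable : forall v, measurable [set w | om v w].
Hypothesis eta_measurable : forall e, measurable [set w | eta e w].

Lemma open_adj_measurable u v : measurable [set w | open_adj om eta w u v].
Proof.
have [<-|uv] := pselect (u = v).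
  have -> : [set w | open_adj om eta w u u] = set0.
    by apply/seteqP; split=> // w [].
  exact: measurable0.
have -> : [set w | open_adj om eta w u v] =
  [set w | om u w] `&` [set w | om v w] `&` [set w | eta (mkE uv) w].
  apply/seteqP; split=> w.
    move=> [_ [ou [ov [e [he eo]]]]]; do 2?split => //=.
    by have <- : e = mkE uv by exact: HEdge_ext.
  by move=> [[ou ov] eo]; do 3?split => //; exists (mkE uv).
by do 2?apply: measurableI.
Qed.

(** Stratifying connection by path length makes it a countable union of events. *)
Fixpoint reach (n : nat) (u v : HL L) (w : T) : Prop :=
  if n is n'.+1 then exists z, reach n' u z w /\ open_adj om eta w z v
  else u = v.

Lemma reachP u v w :
  clos_refl_trans _ (open_adj om eta w) u v <-> exists n, reach n u v w.
Proof.
split.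
  move/(@clos_rt_rtn1 (HL L)); elim=> [|y z yz _ [n hn]]; first by exists 0%N.
  by exists n.+1, y.
case=> n; elim: n v => [|n IH] v /=; first by move=> <-; exact: rt_refl.
by case=> z [/IH uz zv]; apply: (rt_trans _ _ _ _ _ uz); exact: rt_step.
Qed.

Lemma reach_measurable n u v : measurable [set w | reach n u v w].
Proof.
elim: n v => [|n IH] v /=.
  have [<-|uv] := pselect (u = v).
    have -> : [set w : T | u = u] = setT by apply/seteqP; split.
    exact: measurableT.
  have -> : [set w : T | u = v] = set0 by apply/seteqP; split.
  exact: measurable0.
have -> : [set w | exists z, reach n u z w /\ open_adj om eta w z v] =
  \bigcup_z ([set w | reach n u z w] `&` [set w | open_adj om eta w z v]).
  by apply/seteqP; split=> w; [case=> z [h1 h2]; exists z | case=> z _ [h1 h2]; exists z].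
apply: countable_bigcupT_measurable; first exact: HL_countable.
by move=> z; apply: measurableI; [exact: IH | exact: open_adj_measurable].
Qed.

Lemma in_cluster_measurable o v :
  measurable [set w | open_cluster om eta o w v].
Proof.
have -> : [set w | open_cluster om eta o w v] =
  [set w | om o w] `&` \bigcup_n [set w | reach n o v w].
  apply/seteqP; split=> w; case=> h1.
    by move/reachP => [n hn]; split=> //; exists n.
  by case=> n _ hn; split=> //; apply/reachP; exists n.
apply: measurableI; first exact: om_measurable.
by apply: bigcup_measurable => n _; exact: reach_measurable.
Qed.

(** By finiteness of blocks, a cluster is infinite exactly when for every [N] it has a vertex
    nonzero at some index from [N] on. This involves only countable operations. *)
Lemma infinite_cluster_measurable o :
  measurable [set w | ~ finite_set (open_cluster om eta o w)].
Proof.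
have -> : [set w | ~ finite_set (open_cluster om eta o w)] =
  \bigcap_N \bigcup_(v in [set: HL L]) (if `[< exists2 i, (N <= i)%N & sval v i <> 0%N >]
     then [set w | open_cluster om eta o w v] else set0).
  apply/seteqP; split=> w.
    move=> inf N _; apply: contrapT => h; apply: inf.
    apply: (@HL_bounded_finite _ _ N) => v i Kv Ni; apply: contrapT => vi.
    apply: h; exists v => //; case: asboolP => // h; apply: h.
    by exists i.
  move=> h fin; have [N hN] := HL_finite_bounded fin.
  have [v _] := h N I; case: asboolP => // -[i Ni vi] Kv.
  exact: vi (hN _ _ Kv Ni).
apply: bigcap_measurable => [|N _]; first by exists 0%N.
apply: countable_bigcupT_measurable; first exact: HL_countable.
by move=> v; case: ifP => _; [exact: in_cluster_measurable | exact: measurable0].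
Qed.

End InfiniteCluster.

(** Continuity from above along the decreasing tail unions, each of which contains some [F n]. *)
Lemma lim_sup_set_ge (R : realType) (d : measure_display) (T : measurableType d)
  (P : probability T R) (F : nat -> set T) (r : \bar R) :
  (forall n, measurable (F n)) -> (forall n, (r <= P (F n))%E) ->
  (r <= P (lim_sup_set F))%E.
Proof.
move=> mF rF.
have fin : (P (\bigcup_(k >= 0) F k) < +oo)%E.
  apply: (le_lt_trans (probability_le1 P _)); last exact: ltry.
  by apply: bigcup_measurable => k _.
have cv := lim_sup_set_cvg P F mF fin.
rewrite -(cvg_lim _ cv) //; apply: lime_ge; first by apply/cvg_ex; eexists; exact: cv.
apply: nearW => n; apply: (le_trans (rF n)).
apply: le_measure; rewrite ?inE //; first by apply: bigcup_measurable => k _.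
by move=> w Fw; exists n => /=.
Qed.

(** * Positive probability of an infinite cluster *)

Section Percolation.
Variables (R : realType) (l : nat) (q : R) (p b : nat -> R).
Local Notation L := l.+2.
Variables (J : HL L -> HL L -> R) (j : nat -> R).
Hypothesis q01 : 0 <= q <= 1.
Hypothesis p01 : forall k, 0 <= p k <= 1.
Hypothesis pb : forall k n, ((L ^ k) ^ 2 <= 64 * n)%N -> (1 - p k) ^+ n <= b k.
Hypothesis q_near1 : L%:R * (1 - q) <= 1 / 100.
Hypothesis b_sum : forall n, L%:R * \sum_(k < n) L%:R ^+ 2 * b k <= 1 / 100.
Hypothesis Jj : forall x y, x <> y -> J x y = j (level x y).
Hypothesis pj : forall k, p k = 1 - expR (- j k.+1).

Lemma infinite_cluster_pos (d : measure_display) (T : measurableType d)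
  (P : probability T R) om eta (o : HL L) :
  is_PqJ q J P om eta -> (forall i, sval o i = 0%N) ->
  (0 < P [set w | ~ finite_set (open_cluster om eta o w)])%E.
Proof.
move=> PqJ o0; have [mom [meta _]] := PqJ.
pose D k : pred (conf l k.+1) := fun c =>
  (vtx0 l k \in block_cluster (c.1 ord0)) && all_merge (@block_cluster l k) c.
pose F k := [set w | D k (obs om eta k.+1 o w)].
have FP k := obs_event Jj pj PqJ o (D k).
have h : ((1 / 2)%:E <= P (lim_sup_set F))%E.
  apply: lim_sup_set_ge => k; first exact: (FP k).1.
  by rewrite (FP k).2 lee_fin; exact: all_merge_prob pb q_near1 b_sum k.
apply: (@lt_le_trans _ _ (1 / 2)%:E); first by rewrite lte_fin; lra.
apply: (le_trans h); apply: le_measure; rewrite ?inE.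
- by apply: bigcap_measurable => // n _; apply: bigcup_measurable => k _; exact: (FP k).1.
- exact: infinite_cluster_measurable.
(* A finite cluster vanishes from some index [N] on, but an escape at a scale [k >= N] gives a
   vertex nonzero at index [k]. *)
move=> w hw fin; have [N hN] := HL_finite_bounded fin.
have [k /= Nk /andP[h0 hm]] := hw N I.
have [y Ky] := all_merge_escape o0 h0 hm.
by apply; exact: hN Ky Nk.
Qed.

End Percolation.

Lemma ln_nat_ge_half (R : realType) (n : nat) : (2 <= n)%N -> 1 / 2 <= ln (n%:R : R).
Proof.
move=> n2; apply: (@le_trans _ _ (ln (2 : R))); last first.
  by rewrite ler_ln ?posrE ?ltr0n ?ler_nat //; exact: leq_trans n2.
have h : ln (1 + (- (1 / 2)) : R) <= - (1 / 2) by apply: le_ln1Dx; lra.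
have e : (1 + (- (1 / 2)) : R) = 2^-1 by field.
by move: h; rewrite e lnV ?posrE //; lra.
Qed.

(** * Choice of the kernel *)

Section Kernel.
Variables (R : realType) (l : nat) (a : R).
Local Notation L := l.+2.
Local Notation ell := (L%:R : R).
Definition profile (r : R) : R := a * ell * r ^-2 * ln (ln r).

(* Chosen so that [L^3 (cutoff / short_weight + 4 / cutoff) = 1 / 100]. *)
Definition cutoff : nat := (800 * L ^ 3)%N.

Definition short_weight : R := 200 * ell ^+ 3 * cutoff%:R.

(** Altering finitely many levels leaves the asymptotics intact; the large constant controls the
    scales where [4 / k.+1 ^ 2] would not be small enough. *)
Definition level_weight (n : nat) : R :=
  if (n <= cutoff)%N then short_weight else profile (ell ^+ n).

Definition unlinked_bound (k : nat) : R :=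
  if (k < cutoff)%N then short_weight^-1 else 4 / k.+1%:R ^+ 2.

Lemma ell_ge2 : 2 <= ell. Proof. by rewrite ler_nat. Qed.

Lemma cutoff_ge3 : (3 <= cutoff)%N.
Proof. by rewrite /cutoff; have : (0 < L ^ 3)%N by [rewrite expn_gt0]; lia. Qed.

Lemma short_weight_gt0 : 0 < short_weight.
Proof.
by rewrite /short_weight !mulr_gt0 ?exprn_gt0 ?ltr0n.
Qed.

Lemma ln_pow_ge n : n%:R / 2 <= ln (ell ^+ n).
Proof.
rewrite lnXn ?ltr0n // -[leRHS]mulr_natl; apply: ler_wpM2l; first exact: ler0n.
by have := @ln_nat_ge_half R L isT; lra.
Qed.

Lemma ln_pow_gt1 n : (3 <= n)%N -> 1 < ln (ell ^+ n).
Proof.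
move=> n3; apply: lt_le_trans (ln_pow_ge n).
have : 3 <= n%:R :> R by rewrite ler_nat.
lra.
Qed.

Hypothesis ha : 200 * ell < a.

Lemma profile_gt0 n : (3 <= n)%N -> 0 < profile (ell ^+ n).
Proof.
move=> n3; have l2 := ell_ge2; have ha' := ha.
rewrite /profile; apply: mulr_gt0; last exact/ln_gt0/ln_pow_gt1.
apply: mulr_gt0; first by apply: mulr_gt0; lra.
by rewrite invr_gt0 !exprn_gt0 // ltr0n.
Qed.

Lemma level_weight_ge0 n : 0 <= level_weight n.
Proof.
rewrite /level_weight; case: leqP => [_|h]; first exact/ltW/short_weight_gt0.
by apply/ltW/profile_gt0; apply: leq_trans (ltnW h); exact: cutoff_ge3.
Qed.

(* The expected number of edges between two large clusters is at least
   [a / (64 L) * ln (ln L^(k+1)) >= 2 ln (ln L^(k+1))]: this is where [a] large is used. *)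
Lemma profile_decay k m : (2 <= k)%N -> ((L ^ k) ^ 2 <= 64 * m)%N ->
  expR (- (m%:R * profile (ell ^+ k.+1))) <= 4 / k.+1%:R ^+ 2.
Proof.
move=> k2 hm; have l2 := ell_ge2.
set g := ln (ell ^+ k.+1); have g1 : 1 < g by exact: ln_pow_gt1.
have gk : k.+1%:R / 2 <= g := ln_pow_ge k.+1.
have lg : 0 < ln g by exact: ln_gt0.
have h1 : 2 * ln g <= m%:R * profile (ell ^+ k.+1).
  have hm' : (ell ^+ k) ^+ 2 <= 64 * m%:R.
    by move: hm; rewrite -(ler_nat R) !natrX natrM.
  have e0 : 0 < (ell ^+ k.+1) ^+ 2 by rewrite !exprn_gt0 // ltr0n.
  (* By [hm'] the left side is at most [128 * ell ^ 2 * m], below [200 * ell ^ 2 * m]. *)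
  have h2 : 2 * (ell ^+ k.+1) ^+ 2 <= a * ell * m%:R.
    rewrite [ell ^+ k.+1]exprS exprMn.
    have m0 : 0 <= m%:R :> R by exact: ler0n.
    apply: (@le_trans _ _ (2 * (ell ^+ 2 * (64 * m%:R)))).
      by rewrite ler_pM2l // ler_wpM2l // exprn_ge0 // ler0n.
    have h3 : 0 <= (a - 200 * ell) * (ell * m%:R).
      by apply: mulr_ge0; [move: ha; lra | apply: mulr_ge0 => //; lra].
    have h4 : 0 <= ell ^+ 2 * m%:R by rewrite mulr_ge0 ?exprn_ge0 ?ler0n.
    lra.
  by rewrite /profile -/g mulrA ler_pM2r // mulrCA mulrA ler_pdivlMr //.
have g0 : 0 < g by lra.
apply: (@le_trans _ _ (expR (- (2 * ln g)))); first by rewrite ler_expR lerN2.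
rewrite expRN expRM_natl lnK ?posrE //.
have k0 : 0 < k.+1%:R :> R by rewrite ltr0n.
have -> : 4 / k.+1%:R ^+ 2 = ((k.+1%:R / 2) ^+ 2)^-1 :> R.
  by field; rewrite ?gt_eqF.
rewrite lef_pV2 ?posrE ?exprn_gt0 ?divr_gt0 //.
by rewrite !expr2 ler_pM // divr_ge0 // ltW.
Qed.

(** On short scales one edge suffices: [m] is positive, and the exponential of [short_weight]
    exceeds [short_weight]. *)
Lemma unlinked_prob k m : ((L ^ k) ^ 2 <= 64 * m)%N ->
  (1 - (1 - expR (- level_weight k.+1))) ^+ m <= unlinked_bound k.
Proof.
move=> hm; rewrite opprB addrC subrK -expRM_natl mulrN.
rewrite /level_weight /unlinked_bound; case: ltnP => hk; last first.
  by apply: profile_decay => //; apply: leq_trans hk; apply: ltnW; exact: cutoff_ge3.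
have m1 : (1 <= m)%N.
  by case: m hm => //; rewrite muln0 leqn0 !expn_eq0.
have M0 := short_weight_gt0.
rewrite expRN lef_pV2 ?posrE ?expR_gt0 //.
apply: (@le_trans _ _ (1 + m%:R * short_weight)); last exact: expR_ge1Dx.
have : short_weight <= m%:R * short_weight.
  by apply: ler_peMl; [exact: ltW | rewrite ler1n].
lra.
Qed.

Lemma sum_unlinked_bound n :
  \sum_(k < n) unlinked_bound k <= cutoff%:R / short_weight + 4 / cutoff%:R.
Proof.
have M0 := short_weight_gt0.
have c0 : 0 < cutoff%:R :> R by rewrite ltr0n; apply: leq_trans cutoff_ge3.
(* The induction needs the telescoping remainder [- 4 / n], since 4/(n+1)^2 is at most 4/n -
   4/(n+1). *)
suff H : \sum_(k < n) unlinked_bound k <=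
    if (n <= cutoff)%N then n%:R / short_weight
    else cutoff%:R / short_weight + 4 / cutoff%:R - 4 / n%:R.
  apply: (le_trans H); case: leqP => h.
    apply: (@le_trans _ _ (cutoff%:R / short_weight)).
      by rewrite ler_pM2r ?invr_gt0 // ler_nat.
    by rewrite lerDl divr_ge0 // ltW.
  by rewrite gerBl divr_ge0 // ler0n.
elim: n => [|n IH]; first by rewrite big_ord0 leq0n mul0r.
rewrite big_ord_recr /=; have [h|h] := ltnP n cutoff.
  have -> : unlinked_bound n = short_weight^-1 by rewrite /unlinked_bound h.
  move: IH; rewrite (ltnW h) -[n.+1]addn1 natrD mulrDl mul1r => IH.
  by rewrite lerD2r.
have n0 : 0 < n%:R :> R by apply: (lt_le_trans c0); rewrite ler_nat.
have step : 4 / n.+1%:R ^+ 2 <= 4 / n%:R - 4 / n.+1%:R :> R.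
  rewrite -[n.+1]addn1 natrD; set x := n%:R in n0 *.
  have x1 : 0 < x + 1 by lra.
  have -> : 4 / x - 4 / (x + 1) = 4 / (x * (x + 1)) by field; rewrite !gt_eqF.
  apply: ler_wpM2l => //; rewrite lef_pV2 ?posrE ?mulr_gt0 ?exprn_gt0 //.
  by rewrite expr2; lra.
have -> : unlinked_bound n = 4 / n.+1%:R ^+ 2 by rewrite /unlinked_bound ltnNge h.
have : \sum_(k < n) unlinked_bound k <=
    cutoff%:R / short_weight + 4 / cutoff%:R - 4 / n%:R.
  apply: (le_trans IH); case: leqP => // h'.
  have -> : n = cutoff by apply/eqP; rewrite eqn_leq h h'.
  lra.
by move=> H; apply: (le_trans (lerD H step)); rewrite addrA subrK.
Qed.

Lemma total_unlinked_bound n :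
  ell * \sum_(k < n) ell ^+ 2 * unlinked_bound k <= 1 / 100.
Proof.
rewrite -mulr_sumr mulrA -exprS.
have l0 : 0 < ell by rewrite ltr0n.
apply: (le_trans (ler_wpM2l _ (sum_unlinked_bound n))).
  by rewrite exprn_ge0 // ltW.
have c0 : cutoff%:R != 0 :> R.
  by rewrite pnatr_eq0 -lt0n; apply: leq_trans cutoff_ge3.
have ce : cutoff%:R = 800 * ell ^+ 3 by rewrite /cutoff natrM natrX.
have -> : ell ^+ 3 * (cutoff%:R / short_weight + 4 / cutoff%:R) = 1 / 100 :> R.
  rewrite /short_weight ce; field; by rewrite gt_eqF.
exact: lexx.
Qed.

End Kernel.

(** * Verification of the chosen density and kernel *)

Theorem theorem2p1 (R : realType) (L : nat) (a : R) :
  (2 <= L)%N -> 200 * L%:R < a ->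
  exists (q : R) (J : HL L -> HL L -> R),
    0 < q < 1 /\
    iso_inv_kernel J /\
    kernel_equiv J (fun n : R => a * L%:R * n ^-2 * ln (ln n)) /\
    forall (d : measure_display) (T : measurableType d) (P : probability T R)
           (om : HL L -> T -> bool) (eta : HEdge L -> T -> bool) (o : HL L),
      is_PqJ q J P om eta ->
      (forall i, sval o i = 0%N) ->
      (0 < P [set w | ~ finite_set (open_cluster om eta o w)])%E.
Proof.
case: L => [|[|l]] // _ ha.
set ell : R := l.+2%:R; have l2 : 2 <= ell by rewrite ler_nat.
have qe : ell * (1 - (1 - (100 * ell)^-1)) = 1 / 100.
  by field; rewrite gt_eqF //; lra.
have q01 : 0 < 1 - (100 * ell)^-1 < 1.
  have h : 0 < (100 * ell)^-1 by rewrite invr_gt0; lra.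
  have h' : (100 * ell)^-1 < 1 by rewrite invf_lt1; lra.
  by rewrite subr_gt0 h' gtrBl h.
(* This [q] makes [L * (1 - q)] exactly 1/100, the budget of the iteration. *)
exists (1 - (100 * ell)^-1), (fun x y => level_weight l a (level x y)).
split=> //; split; last split.
- split; first by move=> x y _; exact: level_weight_ge0.
  split=> [x y|x y x' y' _ _]; first by rewrite level_sym.
  have l0 : 0 < ell by lra.
  have l1 : ell != 1 by rewrite gt_eqF //; lra.
  by rewrite /hnorm => /(ieexprIn l0 l1) ->.
(* Beyond the cutoff the kernel equals the profile, so the ratio is exactly 1; positivity of the
   profile rules out division by zero. *)
- move=> eps e0; exists (ell ^+ (cutoff l).+1) => x y _.
  rewrite /hnorm ler_eXn2l; last by rewrite -/ell; lra.
  move=> h; rewrite /level_weight leqNgt h /=.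
  rewrite divff ?subrr ?normr0 // gt_eqF //.
  by apply: profile_gt0 => //; exact: leq_trans (cutoff_ge3 l) (ltnW h).
move=> d T P om eta o PqJ o0.
apply: (infinite_cluster_pos (p := fun k => 1 - expR (- level_weight l a k.+1))
  (b := unlinked_bound R l) (j := level_weight l a) _ _ _ _ _ _ _ PqJ) => //.
- by case/andP: q01 => *; apply/andP; split; exact: ltW.
- move=> k; have h0 := expR_gt0 (- level_weight l a k.+1).
  have h1 : expR (- level_weight l a k.+1) <= 1.
    by rewrite -expR0 ler_expR oppr_le0 level_weight_ge0.
  by apply/andP; split; lra.
- exact: unlinked_prob.
- by rewrite qe.
- exact: total_unlinked_bound.
Qed.
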